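(* Let $a\ge0$ and $\gamma_1,\gamma_2\in\mathbb{N}_0$. There exists a positive constant $M_5(\gamma_1,\gamma_2)$ such that for every $f\in C^1_{\gamma_1,\gamma_2}(I)$, all $(x,y)\in I$ and all $n_1,n_2\in\mathbb{N}$, $$\omega_{\gamma_1,\gamma_2}(x,y)\,|K_{n_1,n_2}^a(f;x,y)-f(x,y)|\le M_5(\gamma_1,\gamma_2)\Big\{\|f_x'\|_{\gamma_1,\gamma_2}\frac{\delta_{n_1}^a(x)}{\sqrt{n_1+1}}+\|f_y'\|_{\gamma_1,\gamma_2}\frac{\delta_{n_2}^a(y)}{\sqrt{n_2+1}}\Big\},$$ where $f_x',f_y'$ denote the first order partial derivatives of $f$.
   Context: $I=[0,\infty)\times[0,\infty)$, $\mathbb{N}=\{1,2,\dots\}$, $\mathbb{N}_0=\mathbb{N}\cup\{0\}$; $a\ge0$ is a fixed real parameter (constants may depend on it); functions are real-valued. Operators: let $(n)_0=1$, $(n)_i=n(n+1)\cdots(n+i-1)$ for $i\ge1$, $P_k(n,a)=\sum_{i=0}^{k}\binom{k}{i}(n)_i a^{k-i}$, and $$W_{n,k}^a(x)=e^{-\frac{ax}{1+x}}\frac{P_k(n,a)}{k!}\frac{x^k}{(1+x)^{n+k}},\qquad x\ge0,$$ (with $x^0=1$). Put $W^a_{n_1,n_2,k_1,k_2}(x,y)=W^a_{n_1,k_1}(x)W^a_{n_2,k_2}(y)$ and $$K_{n_1,n_2}^a(f;x,y)=(n_1+1)(n_2+1)\sum_{k_1=0}^\infty\sum_{k_2=0}^\infty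 W^a_{n_1,n_2,k_1,k_2}(x,y)\int_{\frac{k_2}{n_2+1}}^{\frac{k_2+1}{n_2+1}}\int_{\frac{k_1}{n_1+1}}^{\frac{k_1+1}{n_1+1}}f(u,v)\,du\,dv .$$ Weights and spaces: $\omega_\gamma(x)=(1+x^\gamma)^{-1}$ for $\gamma\in\mathbb{N}_0$ (with $x^0=1$), $\omega_{\gamma_1,\gamma_2}(x,y)=\omega_{\gamma_1}(x)\omega_{\gamma_2}(y)$. $C_{\gamma_1,\gamma_2}(I)$ is the set of $f\in C(I)$ such that $\omega_{\gamma_1,\gamma_2}f$ is bounded and uniformly continuous on $I$, with norm $\|f\|_{\gamma_1,\gamma_2}=\sup_{(x,y)\in I}|f(x,y)|\,\omega_{\gamma_1,\gamma_2}(x,y)$. For $m\in\mathbb{N}$, $C^m_{\gamma_1,\gamma_2}(I)$ is the space of $f\in C_{\gamma_1,\gamma_2}(I)$ whose partial derivatives $\frac{\partial^k f}{\partial x^s\partial y^{k-s}}$, $s=0,1,\dots,k$, $k=1,\dots,m$, belong to $C_{\gamma_1,\gamma_2}(I)$. For $x\ge 0$, $\delta_n^a(x)=\sqrt{x(1+x)+\frac{(1+a)^2}{n+1}}$. *)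

(* Defs.v *)
From Stdlib Require Import Reals Factorial.
From Coquelicot Require Import Coquelicot.
Open Scope R_scope.

Definition quadrant (p : R * R) : Prop := 0 <= fst p /\ 0 <= snd p.

Fixpoint rising (n i : nat) : nat :=
  match i with
  | O => 1
  | S j => rising n j * (n + j)
  end.

(* [C] alone would denote Coquelicot's type of complex numbers. *)
Definition P (k n : nat) (a : R) : R :=
  sum_f_R0 (fun i => Binomial.C k i * INR (rising n i) * a ^ (k - i)) k.

Definition W (n k : nat) (a x : R) : R :=
  exp (- (a * x / (1 + x))) * (P k n a / INR (fact k))
    * (x ^ k / (1 + x) ^ (n + k)).

Definition K (n1 n2 : nat) (a : R) (f : R * R -> R) (x y : R) : R :=
  (INR n1 + 1) * (INR n2 + 1) *
  Series (fun k1 => Series (fun k2 =>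
    W n1 k1 a x * W n2 k2 a y *
    RInt (fun v =>
      RInt (fun u => f (u, v)) (INR k1 / (INR n1 + 1))
                               ((INR k1 + 1) / (INR n1 + 1)))
      (INR k2 / (INR n2 + 1)) ((INR k2 + 1) / (INR n2 + 1)))).

Definition omega (g : nat) (x : R) : R := / (1 + x ^ g).

Definition omega2 (g1 g2 : nat) (p : R * R) : R :=
  omega g1 (fst p) * omega g2 (snd p).

(* [ball] on [R * R] is the ball of the maximum distance, which induces the
   same uniformity as the Euclidean one. *)
Definition unif_continuous_on (D : R * R -> Prop) (g : R * R -> R) : Prop :=
  forall eps : posreal, exists delta : posreal,
    forall p q, D p -> D q -> ball p delta q -> ball (g p) eps (g q).

(* Functions are total on [R * R], but only their values on the quadrant
   matter; membership is a condition on these values alone. *)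
Definition C0_w (g1 g2 : nat) (f : R * R -> R) : Prop :=
  continuous_on quadrant f /\
  (exists B, forall p, quadrant p -> Rabs (omega2 g1 g2 p * f p) <= B) /\
  unif_continuous_on quadrant (fun p => omega2 g1 g2 p * f p).

(* [Lub_Rbar] is the supremum in the extended reals; it is finite for
   [f] in [C0_w g1 g2]. *)
Definition norm_w (g1 g2 : nat) (f : R * R -> R) : R :=
  real (Lub_Rbar (fun r =>
    exists p, quadrant p /\ r = Rabs (f p) * omega2 g1 g2 p)).

(* Partial derivatives relative to the quadrant: the increment is restricted
   to nonnegative arguments, so they are one-sided on the boundary. *)
Definition is_partial_x (f : R * R -> R) (p : R * R) (l : R) : Prop :=
  D_in (fun u => f (u, snd p)) (fun _ => l) (fun u => 0 <= u) (fst p).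

Definition is_partial_y (f : R * R -> R) (p : R * R) (l : R) : Prop :=
  D_in (fun v => f (fst p, v)) (fun _ => l) (fun v => 0 <= v) (snd p).

(* [iota] returns the unique real with the given property whenever there is
   one, as in the definition of [RInt]. *)
Definition partial_x (f : R * R -> R) (p : R * R) : R :=
  iota (fun l : R => is_partial_x f p l).

Definition partial_y (f : R * R -> R) (p : R * R) : R :=
  iota (fun l : R => is_partial_y f p l).

Definition C1_w (g1 g2 : nat) (f : R * R -> R) : Prop :=
  C0_w g1 g2 f /\
  (forall p, quadrant p -> exists l, is_partial_x f p l) /\
  (forall p, quadrant p -> exists l, is_partial_y f p l) /\
  C0_w g1 g2 (partial_x f) /\
  C0_w g1 g2 (partial_y f).

Definition delta (n : nat) (a x : R) : R :=
  sqrt (x * (1 + x) + (1 + a) ^ 2 / (INR n + 1)).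

(* Main.v *)
Require Import Defs.
From Stdlib Require Import Reals Lra Lia Factorial.
From Coquelicot Require Import Coquelicot.
Open Scope R_scope.

(** With [t = x / (1 + x)], the weights [W n k a x] are the coefficients in [t]
    of [exp (a t) (1 - t)^(-n)], times [t^k] and the factor that normalizes
    their sum to [1]. So [k |-> W n k a x] is the law of the sum of two
    independent variables, one negative binomial and one Poisson of parameter
    [a t], and [K] averages [f] over cells of side [1/(n1+1)] and [1/(n2+1)]
    chosen at random by two independent such laws. Differentiating the
    generating function gives
      [(k+1) W n (k+1) = a t W n k + n x W (n+1) k]    ([W_shift]),
    which lowers the degree of a moment by one. By induction every power moment
    of [k + 1] is at most a constant times the power of [(n+1)(1+x)]
    ([W_power_moment]), and the first two moments are explicit, so that the
    mean of [(k - (n+1) x)^2] is at most [(n+1) delta^2] ([W_second_moment]).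

    For the operator, move from [(x, y)] to a point [(u, v)] of a cell
    vertically and then horizontally. The mean value theorem bounds the two
    increments of [f] by [norm_w] of a partial derivative, times a distance,
    times the sum of the weights [1 + r^g] at the two ends of the segment,
    times the weight in the other variable ([increment_cell]). Each of the two
    bounds is a function of [k1] times a function of [k2], so their averages are
    products of one-dimensional means ([product_mean_close]). There, a distance
    times a weight is handled by the Cauchy-Schwarz inequality with the second
    moment of the distance and the power moments ([weighted_dist_mean]), and a
    weight alone by the power moments; both bounds carry a factor [1 + x^g] or
    [1 + y^g], which [omega2] cancels. *)

(** * The generating function of the weights *)

(** The coefficient of [t^i] in [(1 - t)^(-n)]. *)
Definition nb_coef (n i : nat) : R := INR (rising n i) / INR (fact i).

Definition exp_coef (a : R) (j : nat) : R := a ^ j / INR (fact j).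

(** The coefficient of [t^k] in [exp (a t) (1 - t)^(-n)]. *)
Definition conv_coef (n : nat) (a : R) (k : nat) : R :=
  sum_f_R0 (fun i => nb_coef n i * exp_coef a (k - i)) k.

Lemma fact_pos (k : nat) : 0 < INR (fact k).
Proof. apply lt_0_INR, lt_O_fact. Qed.

Lemma rising_shift (n i : nat) : (rising n (S i) = n * rising (S n) i)%nat.
Proof.
  induction i as [|i IH].
  - simpl. lia.
  - change (rising n (S (S i))) with (rising n (S i) * (n + S i))%nat.
    change (rising (S n) (S i)) with (rising (S n) i * (S n + i))%nat.
    rewrite IH. nia.
Qed.

(** Coefficientwise, the derivative of [(1 - t)^(-n)] is [n (1 - t)^(-(n+1))]. *)
Lemma nb_coef_shift (n i : nat) :
  INR (S i) * nb_coef n (S i) = INR n * nb_coef (S n) i.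
Proof.
  unfold nb_coef. rewrite rising_shift, fact_simpl, !mult_INR.
  pose proof (fact_pos i). assert (INR (S i) <> 0) by (apply not_0_INR; lia).
  field. split; [lra|assumption].
Qed.

Lemma exp_coef_shift (a : R) (j : nat) :
  INR (S j) * exp_coef a (S j) = a * exp_coef a j.
Proof.
  unfold exp_coef. rewrite fact_simpl, mult_INR. simpl pow.
  pose proof (fact_pos j). assert (INR (S j) <> 0) by (apply not_0_INR; lia).
  field. split; [lra|assumption].
Qed.

(** Coefficientwise, multiplying [(1 - t)^(-n)] by the geometric series. *)
Lemma nb_coef_sum (n k : nat) : sum_f_R0 (nb_coef n) k = nb_coef (S n) k.
Proof.
  induction k as [|k IH].
  - reflexivity.
  - rewrite tech5, IH.
    assert (Hk : INR (S k) <> 0) by (apply not_0_INR; lia).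
    apply Rmult_eq_reg_l with (INR (S k)); [|exact Hk].
    rewrite Rmult_plus_distr_l, nb_coef_shift.
    unfold nb_coef.
    change (rising (S n) (S k)) with (rising (S n) k * (S n + k))%nat.
    rewrite fact_simpl, !mult_INR, plus_INR, !S_INR in *.
    pose proof (fact_pos k). field. split; [lra|assumption].
Qed.

(** Coefficientwise, the derivative of [G n = exp (a t) (1 - t)^(-n)] is
    [a G n + n G (n+1)]; in the convolution, the factor [k + 1] is split as
    [(k + 1 - i) + i] between the exponential and the binomial coefficients. *)
Lemma conv_coef_shift (n : nat) (a : R) (k : nat) :
  INR (S k) * conv_coef n a (S k) =
  a * conv_coef n a k + INR n * conv_coef (S n) a k.
Proof.
  unfold conv_coef.
  rewrite scal_sum.
  rewrite (sum_eq _ (fun i =>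
     nb_coef n i * (INR (S k - i) * exp_coef a (S k - i))
     + INR i * nb_coef n i * exp_coef a (S k - i))).
  2:{ intros i Hi. rewrite minus_INR by exact Hi. ring. }
  rewrite sum_plus. f_equal.
  - rewrite tech5, Nat.sub_diag. simpl INR at 2. rewrite !Rmult_0_l, Rmult_0_r, Rplus_0_r.
    rewrite scal_sum. apply sum_eq. intros i Hi.
    rewrite Nat.sub_succ_l by exact Hi. rewrite exp_coef_shift. ring.
  - rewrite decomp_sum by lia. simpl INR at 1. rewrite !Rmult_0_l, Rplus_0_l.
    simpl Init.Nat.pred. rewrite scal_sum. apply sum_eq. intros i Hi.
    rewrite nb_coef_shift. simpl Nat.sub. ring.
Qed.

Lemma P_conv_coef (k n : nat) (a : R) :
  P k n a / INR (fact k) = conv_coef n a k.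
Proof.
  unfold P, conv_coef, Rdiv. rewrite Rmult_comm, scal_sum.
  apply sum_eq. intros i Hi. unfold Binomial.C, nb_coef, exp_coef.
  pose proof (fact_pos k). pose proof (fact_pos i). pose proof (fact_pos (k - i)).
  field. lra.
Qed.

Lemma nb_coef_pos (n i : nat) : 0 <= nb_coef n i.
Proof.
  unfold nb_coef. apply Rdiv_le_0_compat; [apply pos_INR | apply fact_pos].
Qed.

Lemma is_series_head (u : nat -> R) :
  (forall i, u (S i) = 0) -> is_series u (u 0%nat).
Proof.
  intros Hu. apply is_series_Reals. intros eps Heps. exists 0%nat. intros n _.
  replace (sum_f_R0 u n) with (u 0%nat).
  - now rewrite Rdist_eq.
  - induction n as [|n IH]; [reflexivity|]. rewrite tech5, <- IH, Hu. ring.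
Qed.

(** By induction on [n]: the Cauchy product with the geometric series raises
    the exponent by one. *)
Lemma nb_coef_series (n : nat) (t : R) :
  0 <= t < 1 -> is_series (fun i => nb_coef n i * t ^ i) (/ (1 - t) ^ n).
Proof.
  intros Ht. induction n as [|n IH].
  - replace (/ (1 - t) ^ 0) with (nb_coef 0 0 * t ^ 0)
      by (unfold nb_coef; simpl; field).
    apply is_series_head with (u := fun i => nb_coef 0 i * t ^ i).
    intros i. unfold nb_coef. rewrite rising_shift. simpl. unfold Rdiv. ring.
  - apply (is_series_ext (fun k =>
      sum_f_R0 (fun i => nb_coef n i * t ^ i * t ^ (k - i)) k)).
    { intros k. rewrite <- nb_coef_sum, Rmult_comm, scal_sum.
      apply sum_eq. intros i Hi. rewrite Rmult_assoc, <- pow_add.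
      now replace (i + (k - i))%nat with k by lia. }
    simpl pow. rewrite Rinv_mult, Rmult_comm.
    apply (is_series_mult_pos (fun i => nb_coef n i * t ^ i) (fun j => t ^ j)).
    + exact IH.
    + apply is_series_geom. rewrite Rabs_pos_eq; lra.
    + intros i. apply Rmult_le_pos; [apply nb_coef_pos | apply pow_le; lra].
    + intros i. apply pow_le; lra.
Qed.

Lemma exp_coef_pos (a : R) (j : nat) : 0 <= a -> 0 <= exp_coef a j.
Proof.
  intros Ha. apply Rdiv_le_0_compat; [now apply pow_le | apply fact_pos].
Qed.

Lemma exp_coef_series (a t : R) :
  is_series (fun j => exp_coef a j * t ^ j) (exp (a * t)).
Proof.
  apply is_series_Reals. unfold exp.
  destruct (exist_exp (a * t)) as [l Hl]. simpl.
  intros eps Heps. destruct (Hl eps Heps) as [N HN]. exists N. intros n Hn.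
  rewrite (sum_eq _ (fun i => / INR (fact i) * (a * t) ^ i)); [now apply HN|].
  intros i _. unfold exp_coef. rewrite Rpow_mult_distr. unfold Rdiv. ring.
Qed.

Lemma conv_coef_pos (n : nat) (a : R) (k : nat) :
  0 <= a -> 0 <= conv_coef n a k.
Proof.
  intros Ha. apply cond_pos_sum. intros i.
  apply Rmult_le_pos; [apply nb_coef_pos | now apply exp_coef_pos].
Qed.

Lemma conv_coef_series (n : nat) (a t : R) :
  0 <= a -> 0 <= t < 1 ->
  is_series (fun k => conv_coef n a k * t ^ k) (/ (1 - t) ^ n * exp (a * t)).
Proof.
  intros Ha Ht.
  apply (is_series_ext (fun k => sum_f_R0 (fun i =>
     nb_coef n i * t ^ i * (exp_coef a (k - i) * t ^ (k - i))) k)).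
  { intros k. unfold conv_coef. rewrite (Rmult_comm _ (t ^ k)), scal_sum.
    apply sum_eq. intros i Hi.
    replace (t ^ k) with (t ^ i * t ^ (k - i)); [ring|].
    rewrite <- pow_add. now replace (i + (k - i))%nat with k by lia. }
  apply (is_series_mult_pos (fun i => nb_coef n i * t ^ i)
           (fun j => exp_coef a j * t ^ j)).
  - now apply nb_coef_series.
  - apply exp_coef_series.
  - intros i. apply Rmult_le_pos; [apply nb_coef_pos | apply pow_le; lra].
  - intros i. apply Rmult_le_pos; [now apply exp_coef_pos | apply pow_le; lra].
Qed.

(** The variable [t] of the generating function; [1 - t = / (1 + x)] for
    [x >= 0]. *)
Definition geom_ratio (x : R) : R := x / (1 + x).

Lemma geom_ratio_bounds (x : R) : 0 <= x -> 0 <= geom_ratio x < 1.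
Proof.
  intros Hx. unfold geom_ratio. split.
  - apply Rdiv_le_0_compat; lra.
  - apply Rlt_div_l; lra.
Qed.

Lemma W_conv_coef (n k : nat) (a x : R) : 0 <= x ->
  W n k a x
  = exp (- (a * geom_ratio x)) / (1 + x) ^ n * (conv_coef n a k * geom_ratio x ^ k).
Proof.
  intros Hx. unfold W. rewrite P_conv_coef, pow_add.
  replace (a * x / (1 + x)) with (a * geom_ratio x) by (unfold geom_ratio; field; lra).
  unfold geom_ratio at 3, Rdiv. rewrite Rpow_mult_distr, pow_inv, Rinv_mult. ring.
Qed.

Lemma W_pos (n k : nat) (a x : R) : 0 <= a -> 0 <= x -> 0 <= W n k a x.
Proof.
  intros Ha Hx. rewrite W_conv_coef by exact Hx.
  pose proof (geom_ratio_bounds x Hx).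
  apply Rmult_le_pos.
  - apply Rdiv_le_0_compat; [left; apply exp_pos | apply pow_lt; lra].
  - apply Rmult_le_pos; [now apply conv_coef_pos | apply pow_le; lra].
Qed.

(** The identity behind all moments: it exchanges a factor [k] in a mean
    for a unit shift of the summand, at the price of raising [n] by one in
    part of the sum. *)
Lemma W_shift (n k : nat) (a x : R) : 0 <= x ->
  INR (S k) * W n (S k) a x =
  a * geom_ratio x * W n k a x + INR n * x * W (S n) k a x.
Proof.
  intros Hx. rewrite !W_conv_coef by exact Hx.
  pose proof (conv_coef_shift n a k) as H.
  set (e := exp _). set (t := geom_ratio x) in *.
  transitivity (e / (1 + x) ^ n * (INR (S k) * conv_coef n a (S k)) * (t * t ^ k)).
  { simpl pow. ring. }
  assert (Hp : (1 + x) ^ n <> 0) by (apply pow_nonzero; lra).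
  rewrite H. simpl pow. unfold t, geom_ratio. field. split; [exact Hp | lra].
Qed.

(** * Moments of the weights *)

(** Convergence of the series is part of the relation, so that means are
    added and compared without separate summability conditions. *)
Definition has_mean (n : nat) (a x : R) (phi : nat -> R) (l : R) : Prop :=
  is_series (fun k => W n k a x * phi k) l.

Lemma has_mean_one (n : nat) (a x : R) :
  0 <= a -> 0 <= x -> has_mean n a x (fun _ => 1) 1.
Proof.
  intros Ha Hx. unfold has_mean.
  pose proof (geom_ratio_bounds x Hx) as Ht.
  set (c := exp (- (a * geom_ratio x)) / (1 + x) ^ n).
  apply (is_series_ext (fun k => scal c (conv_coef n a k * geom_ratio x ^ k))).
  { intros k. rewrite W_conv_coef by exact Hx. fold c.
    unfold scal; simpl; unfold mult; simpl. ring. }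
  replace 1 with (scal c (/ (1 - geom_ratio x) ^ n * exp (a * geom_ratio x))).
  2:{ unfold scal; simpl; unfold mult; simpl. unfold c.
      replace (1 - geom_ratio x) with (/ (1 + x)) by (unfold geom_ratio; field; lra).
      assert ((1 + x) ^ n <> 0) by (apply pow_nonzero; lra).
      rewrite pow_inv, Rinv_inv, exp_Ropp.
      pose proof (exp_pos (a * geom_ratio x)). field. split; lra. }
  apply (is_series_scal_l (V := R_NormedModule)).
  now apply conv_coef_series.
Qed.

Lemma has_mean_ext (n : nat) (a x : R) (phi psi : nat -> R) (l : R) :
  (forall k, phi k = psi k) -> has_mean n a x phi l -> has_mean n a x psi l.
Proof.
  intros H. apply is_series_ext. intros k. now rewrite H.
Qed.

Lemma has_mean_lin (n : nat) (a x : R) (c d : R) (phi psi : nat -> R) (l m : R) :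
  has_mean n a x phi l -> has_mean n a x psi m ->
  has_mean n a x (fun k => c * phi k + d * psi k) (c * l + d * m).
Proof.
  intros H1 H2. unfold has_mean.
  apply (is_series_ext (fun k => plus (scal c (W n k a x * phi k))
                                      (scal d (W n k a x * psi k)))).
  { intros k. unfold plus, scal; simpl; unfold mult; simpl. ring. }
  apply (is_series_plus (V := R_NormedModule));
    now apply (is_series_scal_l (V := R_NormedModule)).
Qed.

Lemma has_mean_dom (n : nat) (a x : R) (phi psi : nat -> R) (l : R) :
  0 <= a -> 0 <= x -> (forall k, 0 <= phi k <= psi k) ->
  has_mean n a x psi l -> exists m, has_mean n a x phi m /\ 0 <= m <= l.
Proof.
  intros Ha Hx H Hl.
  assert (Hle : forall k, 0 <= W n k a x * phi k <= W n k a x * psi k).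
  { intros k. pose proof (W_pos n k a x Ha Hx). specialize (H k).
    split; [apply Rmult_le_pos | apply Rmult_le_compat_l]; lra. }
  assert (He : ex_series (fun k => W n k a x * phi k)).
  { apply (ex_series_le (V := R_CompleteNormedModule) _ (fun k => W n k a x * psi k)).
    - intros k. unfold norm; simpl. unfold abs; simpl.
      rewrite Rabs_pos_eq; apply Hle.
    - now exists l. }
  exists (Series (fun k => W n k a x * phi k)). split.
  - now apply Series_correct.
  - rewrite <- (is_series_unique _ _ Hl). split.
    + replace 0 with (Series (fun k => 0 * (W n k a x * phi k)))
        by (rewrite Series_scal_l; ring).
      apply Series_le; [|exact He]. intros k. specialize (Hle k). lra.
    + apply Series_le; [exact Hle|now exists l].
Qed.

Lemma has_mean_shift (n : nat) (a x : R) (phi : nat -> R) (l m : R) :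
  0 <= x ->
  has_mean n a x (fun k => phi (S k)) l ->
  has_mean (S n) a x (fun k => phi (S k)) m ->
  has_mean n a x (fun k => INR k * phi k) (a * geom_ratio x * l + INR n * x * m).
Proof.
  intros Hx H1 H2. unfold has_mean. apply is_series_decr_1.
  replace (plus _ _) with (a * geom_ratio x * l + INR n * x * m).
  2:{ unfold plus, opp; simpl. ring. }
  apply (is_series_ext (fun k => plus (scal (a * geom_ratio x) (W n k a x * phi (S k)))
                             (scal (INR n * x) (W (S n) k a x * phi (S k))))).
  { intros k. unfold plus, scal; cbn -[INR W]; unfold mult; cbn -[INR W].
    transitivity (INR (S k) * W n (S k) a x * phi (S k)).
    - rewrite W_shift by exact Hx. ring.
    - ring. }
  apply (is_series_plus (V := R_NormedModule));
    now apply (is_series_scal_l (V := R_NormedModule)).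
Qed.

Lemma has_mean_id (n : nat) (a x : R) : 0 <= a -> 0 <= x ->
  has_mean n a x INR (a * geom_ratio x + INR n * x).
Proof.
  intros Ha Hx.
  pose proof (has_mean_shift n a x (fun _ => 1) 1 1 Hx
    (has_mean_one n a x Ha Hx) (has_mean_one (S n) a x Ha Hx)) as H.
  rewrite !Rmult_1_r in H. refine (has_mean_ext _ _ _ _ _ _ _ H). intros k. ring.
Qed.

Lemma has_mean_sqr (n : nat) (a x : R) : 0 <= a -> 0 <= x ->
  has_mean n a x (fun k => INR k * INR k)
    (a * geom_ratio x * (a * geom_ratio x + INR n * x + 1)
     + INR n * x * (a * geom_ratio x + (INR n + 1) * x + 1)).
Proof.
  intros Ha Hx.
  assert (H : forall p, has_mean p a x (fun k => INR (S k))
                          (a * geom_ratio x + INR p * x + 1)).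
  { intros p.
    pose proof (has_mean_lin p a x 1 1 _ _ _ _ (has_mean_id p a x Ha Hx)
                  (has_mean_one p a x Ha Hx)) as H.
    rewrite !Rmult_1_l in H. refine (has_mean_ext _ _ _ _ _ _ _ H). intros k.
    rewrite S_INR. ring. }
  pose proof (has_mean_shift n a x INR _ _ Hx (H n) (H (S n))) as H2.
  now rewrite S_INR in H2.
Qed.

(** The exact value is
    [(n+1) x^2 + n x + (a t)^2 + a t - 2 a t x]; the terms of order
    [n^2 x^2] cancel. *)
Lemma W_second_moment (n : nat) (a x : R) : 0 <= a -> 0 <= x ->
  exists l, has_mean n a x (fun k => (INR k - (INR n + 1) * x) ^ 2) l /\
    l <= (INR n + 1) * (x * (1 + x) + (1 + a) ^ 2 / (INR n + 1)).
Proof.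
  intros Ha Hx.
  pose proof (geom_ratio_bounds x Hx) as Ht. pose proof (pos_INR n) as Hn.
  pose proof (has_mean_lin n a x 1 (- 2 * (INR n + 1) * x) _ _ _ _
    (has_mean_sqr n a x Ha Hx) (has_mean_id n a x Ha Hx)) as H1.
  pose proof (has_mean_lin n a x 1 (((INR n + 1) * x) ^ 2) _ _ _ _
    H1 (has_mean_one n a x Ha Hx)) as H2.
  eexists. split.
  - refine (has_mean_ext _ _ _ _ _ _ _ H2). intros k. ring.
  - set (t := geom_ratio x) in *. set (N := INR n) in *.
    replace ((N + 1) * (x * (1 + x) + (1 + a) ^ 2 / (N + 1)))
      with ((N + 1) * (x * (1 + x)) + (1 + a) ^ 2) by (field; lra).
    assert (a * t <= a) by nra. assert (0 <= a * t) by nra.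
    assert (0 <= a * t * x) by (apply Rmult_le_pos; lra).
    nra.
Qed.

(** Induction on [m]: write [(k+1)^(m+1) = (k+1)^m + k (k+1)^m] and apply
    [has_mean_shift] to the second term, using [k + 2 <= 2 (k + 1)] and
    [n + 2 <= 2 (n + 1)]. The bound must be uniform in [n] because the shift
    calls on the law with [n + 1]. *)
Lemma W_power_moment (a : R) (m : nat) : 0 <= a ->
  exists C, 0 <= C /\ forall n x, 0 <= x ->
    exists l, has_mean n a x (fun k => (INR k + 1) ^ m) l /\
      0 <= l <= C * ((INR n + 1) * (1 + x)) ^ m.
Proof.
  intros Ha. induction m as [|m (C & HC & IH)].
  - exists 1. split; [lra|]. intros n x Hx. exists 1. split; [|simpl; lra].
    exact (has_mean_one n a x Ha Hx).
  - assert (H2 : 0 <= 2 ^ m) by (apply pow_le; lra).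
    exists (C + a * 2 ^ m * C + 2 ^ m * 2 ^ m * C). split.
    { assert (0 <= 2 ^ m * C) by now apply Rmult_le_pos.
      assert (0 <= a * (2 ^ m * C)) by now apply Rmult_le_pos. nra. }
    assert (Hs : forall n x, 0 <= x ->
       exists l, has_mean n a x (fun k => (INR (S k) + 1) ^ m) l /\
         0 <= l <= 2 ^ m * C * ((INR n + 1) * (1 + x)) ^ m).
    { intros n x Hx. destruct (IH n x Hx) as (l & Hl & Hl0).
      pose proof (has_mean_lin n a x (2 ^ m) 0 _ _ _ _ Hl Hl) as Hd.
      assert (Hk : forall k, 0 <= (INR (S k) + 1) ^ m
                 <= 2 ^ m * (INR k + 1) ^ m + 0 * (INR k + 1) ^ m).
      { intros k. pose proof (pos_INR k). rewrite S_INR. split.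
        - apply pow_le. lra.
        - rewrite Rmult_0_l, Rplus_0_r, <- Rpow_mult_distr. apply pow_incr. lra. }
      destruct (has_mean_dom n a x _ _ _ Ha Hx Hk Hd) as (l' & Hl' & Hle).
      exists l'. split; [exact Hl'|].
      assert (2 ^ m * l <= 2 ^ m * (C * ((INR n + 1) * (1 + x)) ^ m))
        by (apply Rmult_le_compat_l; lra).
      lra. }
    intros n x Hx.
    destruct (IH n x Hx) as (l0 & Hl0 & Hb0).
    destruct (Hs n x Hx) as (l1 & Hl1 & Hb1).
    destruct (Hs (S n) x Hx) as (l2 & Hl2 & Hb2).
    pose proof (has_mean_shift n a x (fun k => (INR k + 1) ^ m) _ _ Hx Hl1 Hl2) as H3.
    pose proof (has_mean_lin n a x 1 1 _ _ _ _ H3 Hl0) as H4.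
    eexists. split.
    { refine (has_mean_ext _ _ _ _ _ _ _ H4). intros k. simpl pow. ring. }
    pose proof (geom_ratio_bounds x Hx) as Ht. pose proof (pos_INR n) as Hn.
    set (N := INR n) in *. set (t := geom_ratio x) in *.
    set (B := ((N + 1) * (1 + x)) ^ m) in *.
    assert (HB : 0 <= B) by (apply pow_le; nra).
    assert (HB2 : ((INR (S n) + 1) * (1 + x)) ^ m <= 2 ^ m * B).
    { unfold B. rewrite <- Rpow_mult_distr. apply pow_incr.
      rewrite S_INR. fold N. nra. }
    set (q := 2 ^ m) in *.
    assert (Hq : 0 <= q * C) by now apply Rmult_le_pos.
    assert (Hl2' : l2 <= q * C * (q * B)).
    { eapply Rle_trans; [apply Hb2|]. now apply Rmult_le_compat_l. }
    assert (Hqq : 0 <= q * C * (q * B))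
      by (apply Rmult_le_pos; [|apply Rmult_le_pos]; lra).
    assert (HCB : 0 <= C * B) by now apply Rmult_le_pos.
    assert (HqCB : 0 <= q * C * B) by now apply Rmult_le_pos.
    assert (Hat : 0 <= a * t <= a) by nra.
    assert (Hat1 : 0 <= a * t * l1 <= a * (q * C * B)).
    { split; [apply Rmult_le_pos; lra | apply Rmult_le_compat; lra]. }
    assert (Hnx : 0 <= N * x) by now apply Rmult_le_pos.
    assert (Hnx2 : 0 <= N * x * l2 <= N * x * (q * C * (q * B))).
    { split; [apply Rmult_le_pos; lra | apply Rmult_le_compat_l; lra]. }
    assert (HY : 1 <= (N + 1) * (1 + x)) by nra.
    assert (HY' : N * x <= (N + 1) * (1 + x)) by nra.
    simpl pow. fold B. set (Y := (N + 1) * (1 + x)) in *.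
    assert (0 <= a * (q * C * B)) by (apply Rmult_le_pos; lra).
    split; [lra|].
    replace ((C + a * q * C + q * q * C) * (Y * B)) with
      (Y * (C * B) + Y * (a * (q * C * B)) + Y * (q * C * (q * B))) by ring.
    assert (C * B <= Y * (C * B)) by nra.
    assert (a * (q * C * B) <= Y * (a * (q * C * B))) by nra.
    assert (N * x * (q * C * (q * B)) <= Y * (q * C * (q * B)))
      by (apply Rmult_le_compat_r; lra).
    lra.
Qed.

(** * Means of weights and distances over random cells *)

Lemma pow_one_plus_le (g : nat) (x : R) : 0 <= x -> (1 + x) ^ g <= 2 ^ g * (1 + x ^ g).
Proof.
  intros Hx.
  assert (H2 : 0 <= 2 ^ g) by (apply pow_le; lra).
  assert (Hg : 0 <= x ^ g) by now apply pow_le.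
  destruct (Rle_lt_dec x 1) as [H|H].
  - assert ((1 + x) ^ g <= 2 ^ g) by (apply pow_incr; lra). nra.
  - assert ((1 + x) ^ g <= (2 * x) ^ g) by (apply pow_incr; lra).
    rewrite Rpow_mult_distr in *. nra.
Qed.

Lemma cell_power_moment (a : R) (m : nat) : 0 <= a ->
  exists C, 0 <= C /\ forall n x, 0 <= x ->
    exists l, has_mean n a x (fun k => ((INR k + 1) / (INR n + 1)) ^ m) l /\
      0 <= l <= C * (1 + x) ^ m.
Proof.
  intros Ha. destruct (W_power_moment a m Ha) as (C & HC & H).
  exists C. split; [exact HC|]. intros n x Hx.
  destruct (H n x Hx) as (l & Hl & Hb). pose proof (pos_INR n) as Hn.
  assert (Hp : 0 < (INR n + 1) ^ m) by (apply pow_lt; lra).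
  exists (l / (INR n + 1) ^ m). split.
  - replace (l / (INR n + 1) ^ m) with (/ (INR n + 1) ^ m * l + 0 * l)
      by (field; lra).
    refine (has_mean_ext _ _ _ _ _ _ _ (has_mean_lin n a x _ _ _ _ _ _ Hl Hl)).
    intros k. unfold Rdiv. rewrite Rpow_mult_distr, pow_inv. ring.
  - rewrite Rpow_mult_distr in Hb. split.
    + apply Rdiv_le_0_compat; lra.
    + apply Rle_div_l; [exact Hp|]. lra.
Qed.

(** The square of the weight is a combination of the powers of exponents
    [0], [g] and [2 g], and each of their means is bounded by
    [cell_power_moment]. One constant [Q >= 1] serves for both moments. *)
Lemma cell_weight_moments (a : R) (g : nat) : 0 <= a ->
  exists Q, 1 <= Q /\ forall n x, 0 <= x ->
    (exists l, has_mean n a x (fun k => 1 + ((INR k + 1) / (INR n + 1)) ^ g) l /\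
       0 <= l <= Q * (1 + x ^ g)) /\
    (exists l, has_mean n a x (fun k => (1 + ((INR k + 1) / (INR n + 1)) ^ g) ^ 2) l /\
       l <= (Q * (1 + x ^ g)) ^ 2).
Proof.
  intros Ha.
  destruct (cell_power_moment a g Ha) as (C & HC & H1).
  destruct (cell_power_moment a (2 * g) Ha) as (C' & HC' & H2).
  assert (Hp : 1 <= 2 ^ g) by (apply pow_R1_Rle; lra).
  set (q := 2 ^ g) in *.
  exists (1 + C * q + C' * (q * q)).
  assert (HCq : 0 <= C * q) by (apply Rmult_le_pos; lra).
  assert (HCq' : 0 <= C' * (q * q)) by (apply Rmult_le_pos; nra).
  split; [lra|]. intros n x Hx.
  destruct (H1 n x Hx) as (l & Hl & Hb). destruct (H2 n x Hx) as (l' & Hl' & Hb').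
  pose proof (pow_one_plus_le g x Hx) as Hw. fold q in Hw.
  assert (Hg : 0 <= x ^ g) by now apply pow_le.
  assert (Hw0 : 0 <= (1 + x) ^ g) by (apply pow_le; lra).
  set (w := 1 + x ^ g) in *. assert (Hw1 : 1 <= w) by (unfold w; lra).
  assert (Hlw : l <= C * q * w).
  { eapply Rle_trans; [apply Hb|]. rewrite Rmult_assoc. now apply Rmult_le_compat_l. }
  assert (Hlw' : l' <= C' * (q * q) * (w * w)).
  { eapply Rle_trans; [apply Hb'|].
    replace (2 * g)%nat with (g + g)%nat by lia. rewrite pow_add.
    replace (C' * (q * q) * (w * w)) with (C' * ((q * w) * (q * w))) by ring.
    apply Rmult_le_compat_l; [exact HC'|]. now apply Rmult_le_compat. }
  pose proof (has_mean_lin n a x 1 1 _ _ _ _ (has_mean_one n a x Ha Hx) Hl) as Hs.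
  split.
  - eexists. split.
    + refine (has_mean_ext _ _ _ _ _ _ _ Hs). intros k. ring.
    + split; [lra|].
      assert (0 <= C' * (q * q) * w) by (apply Rmult_le_pos; lra). lra.
  - pose proof (has_mean_lin n a x 1 1 _ _ _ _ Hs Hl) as Hs2.
    pose proof (has_mean_lin n a x 1 1 _ _ _ _ Hs2 Hl') as Hs3.
    eexists. split.
    + refine (has_mean_ext _ _ _ _ _ _ _ Hs3). intros k.
      replace (2 * g)%nat with (g + g)%nat by lia. rewrite pow_add. ring.
    + set (u := C * q) in *. set (u' := C' * (q * q)) in *.
      assert (Hww : w <= w * w) by nra.
      assert (Huw : u * w <= u * (w * w)) by now apply Rmult_le_compat_l.
      replace (((1 + u + u') * w) ^ 2) with ((1 + u + u') ^ 2 * (w * w)) by ring.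
      assert (1 + 2 * u + u' <= (1 + u + u') ^ 2).
      { assert (0 <= u * u') by now apply Rmult_le_pos. nra. }
      assert (0 <= w * w) by nra.
      assert ((1 + 2 * u + u') * (w * w) <= (1 + u + u') ^ 2 * (w * w))
        by now apply Rmult_le_compat_r.
      lra.
Qed.

(** The product [p q] is dominated by [B/(2A) p^2 + A/(2B) q^2], so its series
    converges and its mean is bounded at once; this choice of coefficients
    makes the bound [A B]. *)
Lemma cauchy_schwarz_mean (n : nat) (a x : R) (p q : nat -> R) (l m A B : R) :
  0 <= a -> 0 <= x -> 0 < A -> 0 < B ->
  (forall k, 0 <= p k) -> (forall k, 0 <= q k) ->
  has_mean n a x (fun k => p k ^ 2) l -> has_mean n a x (fun k => q k ^ 2) m ->
  l <= A ^ 2 -> m <= B ^ 2 ->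
  exists r, has_mean n a x (fun k => p k * q k) r /\ 0 <= r <= A * B.
Proof.
  intros Ha Hx HA HB Hp Hq Hl Hm HlA HmB.
  set (s := B / (2 * A)). set (t := A / (2 * B)).
  assert (Hs : 0 < s) by (apply Rdiv_lt_0_compat; lra).
  assert (Ht : 0 < t) by (apply Rdiv_lt_0_compat; lra).
  assert (Hpq : forall k, 0 <= p k * q k <= s * p k ^ 2 + t * q k ^ 2).
  { intros k. split; [now apply Rmult_le_pos|].
    (* The difference of the two sides is a square. *)
    assert (E : s * p k ^ 2 + t * q k ^ 2 - p k * q k
                = / (2 * A * B) * (B * p k - A * q k) ^ 2).
    { unfold s, t. field. lra. }
    assert (0 <= / (2 * A * B) * (B * p k - A * q k) ^ 2).
    { apply Rmult_le_pos; [|apply pow2_ge_0]. left. apply Rinv_0_lt_compat. nra. }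
    lra. }
  destruct (has_mean_dom n a x _ _ _ Ha Hx Hpq (has_mean_lin n a x s t _ _ _ _ Hl Hm))
    as (r & Hr & Hb).
  exists r. split; [exact Hr|]. split; [apply Hb|].
  assert (s * l <= s * A ^ 2) by (apply Rmult_le_compat_l; lra).
  assert (t * m <= t * B ^ 2) by (apply Rmult_le_compat_l; lra).
  replace (A * B) with (s * A ^ 2 + t * B ^ 2); [lra|].
  unfold s, t. field. lra.
Qed.

(** An upper bound for the distance from [x] to the points of the [k]-th cell,
    see [cell_dist_max]. *)
Definition cell_dist (n : nat) (x : R) (k : nat) : R :=
  Rabs (INR k / (INR n + 1) - x) + / (INR n + 1).

Lemma cell_dist_pos (n : nat) (x : R) (k : nat) : 0 <= cell_dist n x k.
Proof.
  unfold cell_dist. pose proof (Rabs_pos (INR k / (INR n + 1) - x)).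
  pose proof (pos_INR n). assert (0 < / (INR n + 1)) by (apply Rinv_0_lt_compat; lra).
  lra.
Qed.

Lemma delta_sqr_pos (n : nat) (a x : R) : 0 <= a -> 0 <= x ->
  0 < x * (1 + x) + (1 + a) ^ 2 / (INR n + 1).
Proof.
  intros Ha Hx. pose proof (pos_INR n).
  assert (0 < (1 + a) ^ 2 / (INR n + 1))
    by (apply Rdiv_lt_0_compat; [apply pow_lt|]; lra).
  nra.
Qed.

Lemma cell_dist_second_moment (n : nat) (a x : R) : 0 <= a -> 0 <= x ->
  exists l, has_mean n a x (fun k => cell_dist n x k ^ 2) l /\
    l <= (2 * (delta n a x / sqrt (INR n + 1))) ^ 2.
Proof.
  intros Ha Hx. pose proof (pos_INR n) as Hn.
  pose proof (delta_sqr_pos n a x Ha Hx) as Hd.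
  destruct (W_second_moment n a x Ha Hx) as (l & Hl & Hb).
  replace ((2 * (delta n a x / sqrt (INR n + 1))) ^ 2)
    with (4 * (x * (1 + x) + (1 + a) ^ 2 / (INR n + 1)) / (INR n + 1)).
  2:{ unfold delta. set (y := x * (1 + x) + _) in *.
      assert (Hs : sqrt (INR n + 1) <> 0) by (apply Rgt_not_eq, sqrt_lt_R0; lra).
      replace ((2 * (sqrt y / sqrt (INR n + 1))) ^ 2)
        with (4 * (sqrt y * sqrt y) / (sqrt (INR n + 1) * sqrt (INR n + 1)))
        by (field; exact Hs).
      rewrite !sqrt_sqrt by lra. reflexivity. }
  set (y := x * (1 + x) + _) in *. set (N := INR n + 1) in *.
  assert (HN : 0 < N) by (unfold N; lra).
  assert (Hk : forall k, 0 <= cell_dist n x k ^ 2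
            <= 2 / N ^ 2 * (INR k - N * x) ^ 2 + 2 / N ^ 2 * 1).
  { intros k. split; [apply pow2_ge_0|]. unfold cell_dist. fold N.
    replace (INR k / N - x) with ((INR k - N * x) / N) by (field; lra).
    rewrite <- (pow2_abs (INR k - N * x)).
    unfold Rdiv at 1. rewrite Rabs_mult, (Rabs_pos_eq (/ N))
      by (left; now apply Rinv_0_lt_compat).
    set (r := Rabs _).
    (* [2 r^2 + 2 = (r + 1)^2 + (r - 1)^2]. *)
    replace (2 / N ^ 2 * r ^ 2 + 2 / N ^ 2 * 1) with
      ((r * / N + / N) ^ 2 + ((r - 1) * / N) ^ 2) by (field; lra).
    pose proof (pow2_ge_0 ((r - 1) * / N)). lra. }
  destruct (has_mean_dom n a x _ _ _ Ha Hx Hk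
    (has_mean_lin n a x _ _ _ _ _ _ Hl (has_mean_one n a x Ha Hx))) as (m & Hm & Hmb).
  exists m. split; [exact Hm|].
  assert (H1 : 1 <= N * y).
  { unfold y. replace (N * (x * (1 + x) + (1 + a) ^ 2 / N))
      with (N * (x * (1 + x)) + (1 + a) ^ 2) by (field; lra).
    assert (0 <= N * (x * (1 + x))) by (apply Rmult_le_pos; nra). nra. }
  (* The cell width contributes [2/N^2], absorbed because [1 <= N y]; here
     [y = delta^2]. *)
  replace (4 * y / N) with (2 / N ^ 2 * (N * y) + 2 / N ^ 2 * (N * y)) by (field; lra).
  assert (H2 : 0 < 2 / N ^ 2) by (apply Rdiv_lt_0_compat; [lra | now apply pow_lt]).
  assert (2 / N ^ 2 * l <= 2 / N ^ 2 * (N * y)) by (apply Rmult_le_compat_l; lra).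
  assert (2 / N ^ 2 * 1 <= 2 / N ^ 2 * (N * y)) by (apply Rmult_le_compat_l; lra).
  lra.
Qed.

(** Cauchy-Schwarz is applied twice: against the constant [1], for the weight
    at [x], and against the weight at the end of the cell. *)
Lemma weighted_dist_mean (a : R) (g : nat) : 0 <= a ->
  exists M, 0 < M /\ forall n x, 0 <= x ->
    exists l, has_mean n a x (fun k => cell_dist n x k *
        ((1 + x ^ g) + (1 + ((INR k + 1) / (INR n + 1)) ^ g))) l /\
      0 <= l <= (1 + x ^ g) * (M * (delta n a x / sqrt (INR n + 1))).
Proof.
  intros Ha. destruct (cell_weight_moments a g Ha) as (Q & HQ & H).
  exists (2 * (1 + Q)). split; [lra|]. intros n x Hx.
  pose proof (pos_INR n) as Hn.
  destruct (H n x Hx) as (_ & m & Hm & HmB).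
  destruct (cell_dist_second_moment n a x Ha Hx) as (l & Hl & HlD).
  assert (HD : 0 < delta n a x / sqrt (INR n + 1)).
  { apply Rdiv_lt_0_compat; apply sqrt_lt_R0; [now apply delta_sqr_pos | lra]. }
  set (D := delta n a x / sqrt (INR n + 1)) in *.
  assert (Hg : 0 <= x ^ g) by now apply pow_le.
  set (w := 1 + x ^ g) in *. assert (Hw : 1 <= w) by (unfold w; lra).
  assert (Hcell : forall k, 0 <= 1 + ((INR k + 1) / (INR n + 1)) ^ g).
  { intros k. pose proof (pos_INR k).
    assert (0 <= ((INR k + 1) / (INR n + 1)) ^ g)
      by (apply pow_le, Rdiv_le_0_compat; lra). lra. }
  destruct (cauchy_schwarz_mean n a x (cell_dist n x)
     (fun k => 1 + ((INR k + 1) / (INR n + 1)) ^ g) l m (2 * D) (Q * w))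
    as (r & Hr & Hrb); try assumption; try lra; try nra.
  { apply cell_dist_pos. }
  destruct (cauchy_schwarz_mean n a x (cell_dist n x) (fun _ => 1) l 1 (2 * D) 1)
    as (r' & Hr' & Hrb'); try assumption; try (intros; lra); try lra.
  { apply cell_dist_pos. }
  { refine (has_mean_ext _ _ _ _ _ _ _ (has_mean_one n a x Ha Hx)).
    intros _. ring. }
  pose proof (has_mean_lin n a x w 1 _ _ _ _ Hr' Hr) as Hs.
  eexists. split.
  - refine (has_mean_ext _ _ _ _ _ _ _ Hs). intros k. ring.
  - assert (0 <= w * r' <= w * (2 * D * 1)).
    { split; [apply Rmult_le_pos | apply Rmult_le_compat_l]; lra. }
    split; [lra|].
    replace (w * (2 * (1 + Q) * D)) with (w * (2 * D * 1) + 2 * D * (Q * w)) by ring.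
    lra.
Qed.

(** * Increments of weighted differentiable functions *)

(** The derivative at [0] is one-sided, so the mean value theorem is applied
    to [r |-> h (max 0 r)], which is continuous on the whole line. *)
Lemma mean_value_half_line (h dh : R -> R) (x u : R) :
  (forall s, 0 <= s -> D_in h (fun _ => dh s) (fun r => 0 <= r) s) ->
  0 <= x -> 0 <= u ->
  exists c, Rmin x u <= c <= Rmax x u /\ h u - h x = dh c * (u - x).
Proof.
  intros Hh Hx Hu.
  assert (Hmin : 0 <= Rmin x u) by now apply Rmin_glb.
  destruct (MVT_gen (fun r => h (Rmax 0 r)) x u dh) as (c & Hc & E).
  - intros s Hs. assert (Hs0 : 0 < s) by lra.
    apply is_derive_Reals. intros eps Heps.
    destruct (Hh s (Rlt_le _ _ Hs0) eps Heps) as (alp & Halp & Hlim).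
    assert (Hpos : 0 < Rmin alp s) by now apply Rmin_glb_lt.
    exists (mkposreal _ Hpos). simpl. intros e He0 He.
    assert (Hea : Rabs e < alp) by (eapply Rlt_le_trans; [exact He | apply Rmin_l]).
    assert (Hes : Rabs e < s) by (eapply Rlt_le_trans; [exact He | apply Rmin_r]).
    apply Rabs_def2 in Hes.
    rewrite !Rmax_right by lra.
    specialize (Hlim (s + e)). simpl in Hlim. unfold Rdist in Hlim.
    replace (s + e - s) with e in Hlim by ring.
    apply Hlim. split; [|exact Hea]. split; [lra|]. intros E. apply He0. lra.
  - intros s Hs. assert (Hs0 : 0 <= s) by lra.
    assert (Hcont : continue_in h (fun r => 0 <= r) s).
    { exact (cont_deriv h (fun _ => dh s) _ s (Hh s Hs0)). }
    intros eps Heps. destruct (Hcont eps Heps) as (alp & Halp & Hlim).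
    exists alp. split; [exact Halp|]. simpl. unfold Rdist. intros r [_ Hr].
    rewrite (Rmax_right 0 s) by exact Hs0.
    destruct (Req_dec s (Rmax 0 r)) as [<-|Hne].
    { rewrite Rminus_diag, Rabs_R0. exact Heps. }
    apply (Hlim (Rmax 0 r)). split; [split; [apply Rmax_l | exact Hne]|].
    simpl. unfold Rdist. revert Hr.
    unfold Rmax. destruct (Rle_dec 0 r); [easy|].
    intros Hr. rewrite Rabs_left1 by lra. rewrite Rabs_left1 in Hr by lra. lra.
  - exists c. split; [exact Hc|]. now rewrite !Rmax_right in E.
Qed.

(** The weight increases on the half-line, so between two points it is at
    most its value at the larger one, hence at most the sum of both values;
    this avoids comparing the two points. *)
Lemma weight_between (g : nat) (x u c : R) : 0 <= x -> 0 <= u ->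
  Rmin x u <= c <= Rmax x u -> 1 + c ^ g <= (1 + x ^ g) + (1 + u ^ g).
Proof.
  intros Hx Hu [H1 H2].
  assert (0 <= Rmin x u) by now apply Rmin_glb.
  assert (0 <= x ^ g) by now apply pow_le. assert (0 <= u ^ g) by now apply pow_le.
  assert (Hmax : c ^ g <= Rmax x u ^ g) by (apply pow_incr; lra).
  revert Hmax. unfold Rmax. destruct (Rle_dec x u); lra.
Qed.

Lemma weighted_increment (h dh : R -> R) (B : R) (g : nat) (x u : R) :
  (forall s, 0 <= s -> D_in h (fun _ => dh s) (fun r => 0 <= r) s) ->
  (forall s, 0 <= s -> Rabs (dh s) <= B * (1 + s ^ g)) ->
  0 <= B -> 0 <= x -> 0 <= u ->
  Rabs (h u - h x) <= B * (Rabs (u - x) * ((1 + x ^ g) + (1 + u ^ g))).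
Proof.
  intros Hh HB HB0 Hx Hu.
  destruct (mean_value_half_line h dh x u Hh Hx Hu) as (c & Hc & E).
  assert (Hc0 : 0 <= c).
  { assert (0 <= Rmin x u) by now apply Rmin_glb. lra. }
  rewrite E, Rabs_mult.
  replace (B * _) with (B * ((1 + x ^ g) + (1 + u ^ g)) * Rabs (u - x)) by ring.
  apply Rmult_le_compat_r; [apply Rabs_pos|].
  eapply Rle_trans; [now apply HB|].
  apply Rmult_le_compat_l; [exact HB0|]. now apply weight_between.
Qed.

Lemma half_line_adherent (s : R) : 0 <= s -> adhDa (D_x (fun r => 0 <= r) s) s.
Proof.
  intros Hs alp Halp. exists (s + alp / 2). split.
  - split; lra.
  - unfold Rdist. rewrite Rabs_pos_eq; lra.
Qed.

(** The defining property of [iota] applies since limits of difference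
    quotients are unique: [0 <= r] has no isolated points. *)
Lemma partial_x_correct (f : R * R -> R) (p : R * R) :
  quadrant p -> (exists l, is_partial_x f p l) -> is_partial_x f p (partial_x f p).
Proof.
  intros [Hp _] [l Hl].
  apply (iota_correct (V := R_CompleteNormedModule) (fun l : R => is_partial_x f p l)).
  exists l. split; [exact Hl|]. intros l' Hl'.
  exact (single_limit _ _ _ _ _ (half_line_adherent _ Hp) Hl Hl').
Qed.

Lemma partial_y_correct (f : R * R -> R) (p : R * R) :
  quadrant p -> (exists l, is_partial_y f p l) -> is_partial_y f p (partial_y f p).
Proof.
  intros [_ Hp] [l Hl].
  apply (iota_correct (V := R_CompleteNormedModule) (fun l : R => is_partial_y f p l)).
  exists l. split; [exact Hl|]. intros l' Hl'.
  exact (single_limit _ _ _ _ _ (half_line_adherent _ Hp) Hl Hl').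
Qed.

Lemma weight_pos (g : nat) (x : R) : 0 <= x -> 0 < 1 + x ^ g.
Proof. intros Hx. assert (0 <= x ^ g) by now apply pow_le. lra. Qed.

(** The bound on the weighted function makes the supremum finite, so that
    taking its real part loses nothing. *)
Lemma norm_w_bound (g1 g2 : nat) (f : R * R -> R) (u v : R) :
  C0_w g1 g2 f -> 0 <= u -> 0 <= v ->
  Rabs (f (u, v)) <= norm_w g1 g2 f * (1 + v ^ g2) * (1 + u ^ g1).
Proof.
  intros (_ & (B & HB) & _) Hu Hv.
  assert (Hw : forall p, quadrant p -> 0 < omega2 g1 g2 p).
  { intros p [H1 H2]. unfold omega2, omega.
    apply Rmult_lt_0_compat; apply Rinv_0_lt_compat; now apply weight_pos. }
  assert (Hle : Rabs (f (u, v)) * omega2 g1 g2 (u, v) <= norm_w g1 g2 f).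
  { unfold norm_w.
    destruct (Lub_Rbar_correct (fun r => exists p, quadrant p /\
                r = Rabs (f p) * omega2 g1 g2 p)) as [Hub Hlub].
    set (L := Lub_Rbar _) in *.
    assert (H : Rbar_le (Rabs (f (u, v)) * omega2 g1 g2 (u, v)) L).
    { apply Hub. exists (u, v). now repeat split. }
    assert (H' : Rbar_le L B).
    { apply Hlub. intros r (p & Hp & ->). simpl.
      specialize (HB p Hp). rewrite Rabs_mult, (Rabs_pos_eq (omega2 g1 g2 p)) in HB.
      - lra.
      - left. now apply Hw. }
    destruct L; simpl in *; easy. }
  unfold omega2, omega in Hle. simpl in Hle.
  pose proof (weight_pos g1 u Hu). pose proof (weight_pos g2 v Hv).
  rewrite <- Rinv_mult in Hle. apply Rle_div_l in Hle; [|now apply Rmult_lt_0_compat].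
  lra.
Qed.

Lemma norm_w_pos (g1 g2 : nat) (f : R * R -> R) :
  C0_w g1 g2 f -> 0 <= norm_w g1 g2 f.
Proof.
  intros Hf. pose proof (norm_w_bound g1 g2 f 0 0 Hf (Rle_refl 0) (Rle_refl 0)) as H.
  pose proof (Rabs_pos (f (0, 0))) as H0.
  pose proof (weight_pos g1 0 (Rle_refl 0)). pose proof (weight_pos g2 0 (Rle_refl 0)).
  destruct (Rle_lt_dec 0 (norm_w g1 g2 f)) as [Hn|Hn]; [exact Hn|].
  assert (0 < (1 + 0 ^ g2) * (1 + 0 ^ g1)) by now apply Rmult_lt_0_compat.
  nra.
Qed.

Lemma increment_x (g1 g2 : nat) (f : R * R -> R) (x u v : R) :
  C1_w g1 g2 f -> 0 <= x -> 0 <= u -> 0 <= v ->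
  Rabs (f (u, v) - f (x, v)) <=
  norm_w g1 g2 (partial_x f) * (1 + v ^ g2)
    * (Rabs (u - x) * ((1 + x ^ g1) + (1 + u ^ g1))).
Proof.
  intros (_ & Hx1 & _ & HC & _) Hx Hu Hv.
  apply (weighted_increment (fun s => f (s, v)) (fun s => partial_x f (s, v)));
    try assumption.
  - intros s Hs. assert (Hp : quadrant (s, v)) by now split.
    exact (partial_x_correct f (s, v) Hp (Hx1 _ Hp)).
  - intros s Hs. now apply norm_w_bound.
  - apply Rmult_le_pos; [now apply norm_w_pos | left; now apply weight_pos].
Qed.

Lemma increment_y (g1 g2 : nat) (f : R * R -> R) (u y v : R) :
  C1_w g1 g2 f -> 0 <= u -> 0 <= y -> 0 <= v ->
  Rabs (f (u, v) - f (u, y)) <=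
  norm_w g1 g2 (partial_y f) * (1 + u ^ g1)
    * (Rabs (v - y) * ((1 + y ^ g2) + (1 + v ^ g2))).
Proof.
  intros (_ & _ & Hy1 & _ & HC) Hu Hy Hv.
  apply (weighted_increment (fun s => f (u, s)) (fun s => partial_y f (u, s)));
    try assumption.
  - intros s Hs. assert (Hp : quadrant (u, s)) by now split.
    exact (partial_y_correct f (u, s) Hp (Hy1 _ Hp)).
  - intros s Hs. pose proof (norm_w_bound g1 g2 _ u s HC Hu Hs). lra.
  - apply Rmult_le_pos; [now apply norm_w_pos | left; now apply weight_pos].
Qed.

(** * Averages over cells *)

Definition lipschitz_on (c d L : R) (h : R -> R) : Prop :=
  forall r s, c <= r <= d -> c <= s <= d -> Rabs (h r - h s) <= L * Rabs (r - s).

(** Composing [h] with the projection of the line onto [[c, d]] makes it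
    continuous everywhere without changing it on the interval, whatever [h]
    is outside. *)
Lemma lipschitz_ex_RInt (c d L : R) (h : R -> R) :
  c <= d -> lipschitz_on c d L h -> ex_RInt h c d.
Proof.
  intros Hcd HL.
  set (cl := fun r => Rmax c (Rmin d r)).
  assert (Hcl : forall r, c <= cl r <= d).
  { intros r. unfold cl. split; [apply Rmax_l|].
    apply Rmax_lub; [exact Hcd | apply Rmin_l]. }
  assert (Hcl1 : forall r s, Rabs (cl r - cl s) <= Rabs (r - s)).
  { intros r s. unfold cl, Rmax, Rmin.
    destruct (Rle_dec d r), (Rle_dec d s); repeat destruct (Rle_dec c _);
      unfold Rabs; repeat destruct (Rcase_abs _); lra. }
  apply (ex_RInt_ext (fun r => h (cl r))).
  { intros r. rewrite Rmin_left, Rmax_right by exact Hcd. intros Hr.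
    unfold cl. now rewrite Rmin_right, Rmax_right by lra. }
  apply (ex_RInt_continuous (V := R_CompleteNormedModule)). intros z _.
  apply continuity_pt_filterlim. intros eps Heps.
  assert (HL1 : 0 < Rabs L + 1) by (pose proof (Rabs_pos L); lra).
  exists (eps / (Rabs L + 1)). split; [now apply Rdiv_lt_0_compat|].
  simpl. unfold Rdist. intros r [_ Hr].
  apply Rlt_div_r in Hr; [|exact HL1].
  eapply Rle_lt_trans; [|exact Hr].
  eapply Rle_trans; [apply HL; apply Hcl|].
  eapply Rle_trans; [apply Rmult_le_compat_r; [apply Rabs_pos | apply Rle_abs]|].
  specialize (Hcl1 r z).
  assert (Rabs L * Rabs (cl r - cl z) <= Rabs L * Rabs (r - z))
    by (apply Rmult_le_compat_l; [apply Rabs_pos | exact Hcl1]).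
  pose proof (Rabs_pos (r - z)). lra.
Qed.

Lemma average_bound (c d F b : R) (h : R -> R) :
  c < d -> ex_RInt h c d -> (forall r, c <= r <= d -> Rabs (h r - F) <= b) ->
  Rabs (/ (d - c) * RInt h c d - F) <= b.
Proof.
  intros Hcd Hh Hb.
  assert (Hk : ex_RInt (fun _ => F) c d) by apply ex_RInt_const.
  pose proof (abs_RInt_le_const (fun r => minus (h r) F) c d b (Rlt_le _ _ Hcd)
    (ex_RInt_minus (V := R_NormedModule) h (fun _ => F) c d Hh Hk) Hb) as H.
  rewrite (RInt_minus (V := R_CompleteNormedModule)), RInt_const in H by assumption.
  unfold minus, plus, opp, scal in H; simpl in H; unfold mult in H; simpl in H.
  replace (/ (d - c) * RInt h c d - F)
    with (/ (d - c) * (RInt h c d + - ((d - c) * F))) by (field; lra).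
  rewrite Rabs_mult, Rabs_pos_eq by (left; apply Rinv_0_lt_compat; lra).
  rewrite Rmult_comm. apply Rle_div_l; lra.
Qed.

(** The Lipschitz condition in [v] makes the inner integral a Lipschitz
    function of [v], hence integrable; the bound then follows by averaging
    twice. *)
Lemma box_average_bound (c d c' d' L L' F b : R) (f : R * R -> R) :
  c < d -> c' < d' ->
  (forall v, c' <= v <= d' -> lipschitz_on c d L (fun u => f (u, v))) ->
  (forall u, c <= u <= d -> lipschitz_on c' d' L' (fun v => f (u, v))) ->
  (forall u v, c <= u <= d -> c' <= v <= d' -> Rabs (f (u, v) - F) <= b) ->
  Rabs (/ (d - c) * / (d' - c') * RInt (fun v => RInt (fun u => f (u, v)) c d) c' d' - F)
    <= b.
Proof.
  intros Hc Hc' HL HL' Hb.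
  assert (Hin : forall v, c' <= v <= d' -> ex_RInt (fun u => f (u, v)) c d).
  { intros v Hv. apply lipschitz_ex_RInt with L; [lra | now apply HL]. }
  assert (Hout : ex_RInt (fun v => RInt (fun u => f (u, v)) c d) c' d').
  { apply lipschitz_ex_RInt with ((d - c) * L'); [lra|]. intros r s Hr Hs.
    pose proof (RInt_minus (V := R_CompleteNormedModule) _ _ c d (Hin r Hr) (Hin s Hs))
      as E.
    change (Rabs (minus (RInt (fun u => f (u, r)) c d) (RInt (fun u => f (u, s)) c d))
            <= (d - c) * L' * Rabs (r - s)).
    rewrite <- E, Rmult_assoc. apply abs_RInt_le_const; [lra| |].
    - apply (ex_RInt_minus (V := R_NormedModule)); now apply Hin.
    - intros u Hu. now apply (HL' u Hu r s). }
  replace (/ (d - c) * / (d' - c') * RInt (fun v => RInt (fun u => f (u, v)) c d) c' d')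
    with (/ (d' - c') * RInt (fun v => / (d - c) * RInt (fun u => f (u, v)) c d) c' d').
  2:{ pose proof (RInt_scal (V := R_CompleteNormedModule)
        (fun v => RInt (fun u => f (u, v)) c d) c' d' (/ (d - c)) Hout) as E.
      unfold scal in E; simpl in E; unfold mult in E; simpl in E. rewrite E. ring. }
  apply average_bound; [exact Hc'| |].
  - exact (ex_RInt_scal (V := R_NormedModule) _ c' d' (/ (d - c)) Hout).
  - intros v Hv. apply average_bound; [exact Hc | now apply Hin |].
    intros u Hu. now apply Hb.
Qed.

(** * The error of the operator *)

(** The function [phi - F + psi] lies between [0] and [2 psi], so its mean
    exists and lies between [0] and [2 l]. *)
Lemma mean_close (n : nat) (a x : R) (phi psi : nat -> R) (F l : R) :
  0 <= a -> 0 <= x -> (forall k, Rabs (phi k - F) <= psi k) ->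
  has_mean n a x psi l -> exists m, has_mean n a x phi m /\ Rabs (m - F) <= l.
Proof.
  intros Ha Hx H Hl.
  assert (Hk : forall k, 0 <= phi k - F + psi k <= 1 * psi k + 1 * psi k).
  { intros k. specialize (H k). apply Rabs_le_between in H. lra. }
  destruct (has_mean_dom n a x _ _ _ Ha Hx Hk (has_mean_lin n a x 1 1 _ _ _ _ Hl Hl))
    as (m & Hm & Hb).
  pose proof (has_mean_lin n a x 1 (-1) _ _ _ _ Hm Hl) as H1.
  pose proof (has_mean_lin n a x 1 F _ _ _ _ H1 (has_mean_one n a x Ha Hx)) as H2.
  eexists. split.
  - refine (has_mean_ext _ _ _ _ _ _ _ H2). intros k. ring.
  - apply Rabs_le_between. lra.
Qed.

(** The inner sums [m i] are themselves within a one-dimensional error of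
    [F], so [mean_close] is used first in [j] for each [i], then in [i]. *)
Lemma product_mean_close (n1 n2 : nat) (a x y : R) (J : nat -> nat -> R)
    (F c1 c2 lA lB lD : R) (A B D : nat -> R) :
  0 <= a -> 0 <= x -> 0 <= y ->
  has_mean n1 a x A lA -> has_mean n2 a y B lB -> has_mean n2 a y D lD ->
  (forall i j, Rabs (J i j - F) <= c1 * (A i * B j) + c2 * D j) ->
  Rabs (Series (fun i => Series (fun j => W n1 i a x * W n2 j a y * J i j)) - F)
    <= c1 * (lA * lB) + c2 * lD.
Proof.
  intros Ha Hx Hy HA HB HD HJ.
  set (m := fun i => Series (fun j => W n2 j a y * J i j)).
  assert (Hm : forall i, Rabs (m i - F) <= (c1 * lB) * A i + (c2 * lD) * 1).
  { intros i.
    destruct (mean_close n2 a y (J i) (fun j => (c1 * A i) * B j + c2 * D j) F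
      (c1 * A i * lB + c2 * lD) Ha Hy) as (l & Hl & Hb).
    - intros j. specialize (HJ i j). lra.
    - now apply has_mean_lin.
    - replace (m i) with l by (symmetry; now apply is_series_unique). lra. }
  destruct (mean_close n1 a x m _ F _ Ha Hx Hm
    (has_mean_lin n1 a x _ _ _ _ _ _ HA (has_mean_one n1 a x Ha Hx))) as (l & Hl & Hb).
  rewrite (Series_ext _ (fun i => W n1 i a x * m i)).
  - rewrite (is_series_unique _ _ Hl). lra.
  - intros i. unfold m. rewrite <- Series_scal_l. apply Series_ext. intros j. ring.
Qed.

Lemma cell_bounds (n k : nat) :
  0 <= INR k / (INR n + 1) < (INR k + 1) / (INR n + 1) /\
  / ((INR k + 1) / (INR n + 1) - INR k / (INR n + 1)) = INR n + 1.
Proof.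
  pose proof (pos_INR n). pose proof (pos_INR k). repeat split.
  - apply Rdiv_le_0_compat; lra.
  - unfold Rdiv. apply Rmult_lt_compat_r; [apply Rinv_0_lt_compat|]; lra.
  - field. split; lra.
Qed.

Lemma cell_dist_max (n k : nat) (x u : R) :
  INR k / (INR n + 1) <= u <= (INR k + 1) / (INR n + 1) ->
  Rabs (u - x) <= cell_dist n x k.
Proof.
  intros Hu. pose proof (pos_INR n). unfold cell_dist.
  replace (u - x) with ((INR k / (INR n + 1) - x) + (u - INR k / (INR n + 1))) by ring.
  eapply Rle_trans; [apply Rabs_triang|]. apply Rplus_le_compat_l.
  rewrite Rabs_pos_eq by lra.
  replace ((INR k + 1) / (INR n + 1)) with (INR k / (INR n + 1) + / (INR n + 1)) in Hu
    by (field; lra).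
  lra.
Qed.

(** The path goes through [(x, v)], so the first increment is weighted at
    height [v] and the second one at abscissa [x]. *)
Lemma increment_cell (g1 g2 : nat) (f : R * R -> R) (x y : R) (n1 n2 i j : nat)
    (u v : R) :
  C1_w g1 g2 f -> 0 <= x -> 0 <= y ->
  INR i / (INR n1 + 1) <= u <= (INR i + 1) / (INR n1 + 1) ->
  INR j / (INR n2 + 1) <= v <= (INR j + 1) / (INR n2 + 1) ->
  Rabs (f (u, v) - f (x, y)) <=
    norm_w g1 g2 (partial_x f) *
      (cell_dist n1 x i * ((1 + x ^ g1) + (1 + ((INR i + 1) / (INR n1 + 1)) ^ g1))
       * (1 + ((INR j + 1) / (INR n2 + 1)) ^ g2))
    + norm_w g1 g2 (partial_y f) * (1 + x ^ g1) *
      (cell_dist n2 y j * ((1 + y ^ g2) + (1 + ((INR j + 1) / (INR n2 + 1)) ^ g2))).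
Proof.
  intros Hf Hx Hy Hu Hv.
  destruct (cell_bounds n1 i) as [Hi _]. destruct (cell_bounds n2 j) as [Hj _].
  assert (Hu0 : 0 <= u) by lra. assert (Hv0 : 0 <= v) by lra.
  replace (f (u, v) - f (x, y)) with ((f (u, v) - f (x, v)) + (f (x, v) - f (x, y)))
    by ring.
  eapply Rle_trans; [apply Rabs_triang|]. apply Rplus_le_compat.
  - eapply Rle_trans; [apply (increment_x g1 g2); assumption|].
    rewrite Rmult_assoc. apply Rmult_le_compat_l; [apply norm_w_pos, Hf|].
    rewrite Rmult_comm.
    pose proof (weight_pos g1 x Hx). pose proof (weight_pos g1 u Hu0).
    pose proof (weight_pos g2 v Hv0).
    assert (u ^ g1 <= ((INR i + 1) / (INR n1 + 1)) ^ g1) by (apply pow_incr; lra).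
    assert (v ^ g2 <= ((INR j + 1) / (INR n2 + 1)) ^ g2) by (apply pow_incr; lra).
    apply Rmult_le_compat; [| lra | | lra].
    + apply Rmult_le_pos; [apply Rabs_pos | lra].
    + apply Rmult_le_compat; [apply Rabs_pos | lra | now apply cell_dist_max | lra].
  - eapply Rle_trans; [apply (increment_y g1 g2); assumption|].
    pose proof (weight_pos g1 x Hx) as Hw.
    apply Rmult_le_compat_l.
    + apply Rmult_le_pos; [apply norm_w_pos, Hf | lra].
    + pose proof (weight_pos g2 y Hy). pose proof (weight_pos g2 v Hv0).
      assert (v ^ g2 <= ((INR j + 1) / (INR n2 + 1)) ^ g2) by (apply pow_incr; lra).
      apply Rmult_le_compat; [apply Rabs_pos | lra | now apply cell_dist_max | lra].
Qed.

(** Integrability over the cells rests on this: it speaks of [f] inside the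
    quadrant alone, so it covers the cells that touch the axes. *)
Lemma C1_w_lipschitz_x (g1 g2 : nat) (f : R * R -> R) (c d c' d' : R) :
  C1_w g1 g2 f -> 0 <= c -> 0 <= c' ->
  exists L, forall v, c' <= v <= d' -> lipschitz_on c d L (fun u => f (u, v)).
Proof.
  intros Hf Hc Hc'.
  exists (norm_w g1 g2 (partial_x f) * (1 + d' ^ g2) * ((1 + d ^ g1) + (1 + d ^ g1))).
  intros v Hv r s Hr Hs.
  eapply Rle_trans; [apply increment_x with (1 := Hf); lra|].
  assert (HN : 0 <= norm_w g1 g2 (partial_x f)) by apply norm_w_pos, Hf.
  assert (s ^ g1 <= d ^ g1) by (apply pow_incr; lra).
  assert (r ^ g1 <= d ^ g1) by (apply pow_incr; lra).
  assert (v ^ g2 <= d' ^ g2) by (apply pow_incr; lra).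
  assert (0 < 1 + v ^ g2) by (apply weight_pos; lra).
  assert (0 < 1 + s ^ g1) by (apply weight_pos; lra).
  assert (0 < 1 + r ^ g1) by (apply weight_pos; lra).
  rewrite (Rmult_assoc _ _ (Rabs (r - s))), (Rmult_comm (1 + d ^ g1 + _)).
  apply Rmult_le_compat.
  - apply Rmult_le_pos; lra.
  - apply Rmult_le_pos; [apply Rabs_pos | lra].
  - apply Rmult_le_compat_l; lra.
  - apply Rmult_le_compat_l; [apply Rabs_pos | lra].
Qed.

Lemma C1_w_lipschitz_y (g1 g2 : nat) (f : R * R -> R) (c d c' d' : R) :
  C1_w g1 g2 f -> 0 <= c -> 0 <= c' ->
  exists L, forall u, c <= u <= d -> lipschitz_on c' d' L (fun v => f (u, v)).
Proof.
  intros Hf Hc Hc'.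
  exists (norm_w g1 g2 (partial_y f) * (1 + d ^ g1) * ((1 + d' ^ g2) + (1 + d' ^ g2))).
  intros u Hu r s Hr Hs.
  eapply Rle_trans; [apply increment_y with (1 := Hf); lra|].
  assert (HN : 0 <= norm_w g1 g2 (partial_y f)) by apply norm_w_pos, Hf.
  assert (s ^ g2 <= d' ^ g2) by (apply pow_incr; lra).
  assert (r ^ g2 <= d' ^ g2) by (apply pow_incr; lra).
  assert (u ^ g1 <= d ^ g1) by (apply pow_incr; lra).
  assert (0 < 1 + u ^ g1) by (apply weight_pos; lra).
  assert (0 < 1 + s ^ g2) by (apply weight_pos; lra).
  assert (0 < 1 + r ^ g2) by (apply weight_pos; lra).
  rewrite (Rmult_assoc _ _ (Rabs (r - s))), (Rmult_comm (1 + d' ^ g2 + _)).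
  apply Rmult_le_compat.
  - apply Rmult_le_pos; lra.
  - apply Rmult_le_pos; [apply Rabs_pos | lra].
  - apply Rmult_le_compat_l; lra.
  - apply Rmult_le_compat_l; [apply Rabs_pos | lra].
Qed.

(** The factor [(n1+1)(n2+1)] is the inverse of the area of a cell, so the
    integrals in [K] become averages of [f]. *)
Lemma K_error_bound (g1 g2 : nat) (f : R * R -> R) (a x y : R) (n1 n2 : nat)
    (lA lB lD : R) :
  C1_w g1 g2 f -> 0 <= a -> 0 <= x -> 0 <= y ->
  has_mean n1 a x (fun k => cell_dist n1 x k *
     ((1 + x ^ g1) + (1 + ((INR k + 1) / (INR n1 + 1)) ^ g1))) lA ->
  has_mean n2 a y (fun k => 1 + ((INR k + 1) / (INR n2 + 1)) ^ g2) lB ->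
  has_mean n2 a y (fun k => cell_dist n2 y k *
     ((1 + y ^ g2) + (1 + ((INR k + 1) / (INR n2 + 1)) ^ g2))) lD ->
  Rabs (K n1 n2 a f x y - f (x, y)) <=
    norm_w g1 g2 (partial_x f) * (lA * lB)
    + norm_w g1 g2 (partial_y f) * (1 + x ^ g1) * lD.
Proof.
  intros Hf Ha Hx Hy HA HB HD.
  set (cell := fun i j => RInt (fun v =>
      RInt (fun u => f (u, v)) (INR i / (INR n1 + 1)) ((INR i + 1) / (INR n1 + 1)))
      (INR j / (INR n2 + 1)) ((INR j + 1) / (INR n2 + 1))).
  assert (HK : K n1 n2 a f x y = Series (fun i => Series (fun j =>
     W n1 i a x * W n2 j a y * ((INR n1 + 1) * (INR n2 + 1) * cell i j)))).
  { unfold K. rewrite <- Series_scal_l. apply Series_ext. intros i.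
    rewrite <- Series_scal_l. apply Series_ext. intros j. fold (cell i j). ring. }
  rewrite HK.
  apply (product_mean_close n1 n2 a x y _ _ _ _ _ _ _ _ _ _ Ha Hx Hy HA HB HD).
  intros i j.
  destruct (cell_bounds n1 i) as [Hi Ei]. destruct (cell_bounds n2 j) as [Hj Ej].
  destruct (C1_w_lipschitz_x g1 g2 f (INR i / (INR n1 + 1)) ((INR i + 1) / (INR n1 + 1))
    (INR j / (INR n2 + 1)) ((INR j + 1) / (INR n2 + 1)) Hf) as (L & HL); [lra..|].
  destruct (C1_w_lipschitz_y g1 g2 f (INR i / (INR n1 + 1)) ((INR i + 1) / (INR n1 + 1))
    (INR j / (INR n2 + 1)) ((INR j + 1) / (INR n2 + 1)) Hf) as (L' & HL'); [lra..|].
  rewrite <- Ei at 1. rewrite <- Ej at 1.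
  apply box_average_bound with L L'; [lra | lra | exact HL | exact HL' |].
  intros u v Hu Hv. now apply increment_cell.
Qed.

Theorem theorem2 (a : R) (g1 g2 : nat) (ha : 0 <= a) :
  exists M5 : R, 0 < M5 /\
    forall f : R * R -> R, C1_w g1 g2 f ->
    forall x y : R, quadrant (x, y) ->
    forall n1 n2 : nat, (1 <= n1)%nat -> (1 <= n2)%nat ->
      omega2 g1 g2 (x, y) * Rabs (K n1 n2 a f x y - f (x, y)) <=
      M5 * (norm_w g1 g2 (partial_x f) * (delta n1 a x / sqrt (INR n1 + 1))
            + norm_w g1 g2 (partial_y f) * (delta n2 a y / sqrt (INR n2 + 1))).
Proof.
  destruct (weighted_dist_mean a g1 ha) as (M & HM & H1).
  destruct (weighted_dist_mean a g2 ha) as (M' & HM' & H2).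
  destruct (cell_weight_moments a g2 ha) as (Q & HQ & H3).
  assert (HMQ : 0 < M * Q) by (apply Rmult_lt_0_compat; lra).
  exists (M * Q + M'). split; [lra|].
  intros f Hf x y [Hx Hy] n1 n2 _ _. simpl in Hx, Hy.
  destruct (H1 n1 x Hx) as (lA & HA & HAb).
  destruct (H2 n2 y Hy) as (lD & HD & HDb).
  destruct (H3 n2 y Hy) as ((lB & HB & HBb) & _).
  pose proof (K_error_bound g1 g2 f a x y n1 n2 lA lB lD Hf ha Hx Hy HA HB HD) as HK.
  assert (HNx : 0 <= norm_w g1 g2 (partial_x f)) by apply norm_w_pos, Hf.
  assert (HNy : 0 <= norm_w g1 g2 (partial_y f)) by apply norm_w_pos, Hf.
  assert (Hd : forall n z, 0 <= delta n a z / sqrt (INR n + 1)).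
  { intros n z. apply Rdiv_le_0_compat; [apply sqrt_pos|].
    apply sqrt_lt_R0. pose proof (pos_INR n). lra. }
  pose proof (Hd n1 x) as HD1. pose proof (Hd n2 y) as HD2.
  set (D1 := delta n1 a x / _) in *. set (D2 := delta n2 a y / _) in *.
  clearbody D1 D2.
  set (Nx := norm_w g1 g2 (partial_x f)) in *.
  set (Ny := norm_w g1 g2 (partial_y f)) in *.
  unfold omega2, omega. simpl fst. simpl snd.
  pose proof (weight_pos g1 x Hx) as Hw1. pose proof (weight_pos g2 y Hy) as Hw2.
  set (w1 := 1 + x ^ g1) in *. set (w2 := 1 + y ^ g2) in *.
  rewrite <- Rinv_mult, Rmult_comm. apply Rle_div_l; [now apply Rmult_lt_0_compat|].
  eapply Rle_trans; [exact HK|].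
  assert (HAB : lA * lB <= w1 * (M * D1) * (Q * w2)) by (apply Rmult_le_compat; lra).
  apply (Rmult_le_compat_l Nx) in HAB; [|exact HNx].
  assert (HDD : Ny * w1 * lD <= Ny * w1 * (w2 * (M' * D2))).
  { apply Rmult_le_compat_l; [apply Rmult_le_pos|]; lra. }
  assert (HX : 0 <= M' * (w1 * w2) * (Nx * D1)).
  { repeat apply Rmult_le_pos; lra. }
  assert (HY : 0 <= M * Q * (w1 * w2) * (Ny * D2)).
  { repeat apply Rmult_le_pos; lra. }
  lra.
Qed.
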